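(* Let $N$ be a pointed metric space, regard $[0,1]$ (with its usual metric) as a pointed metric space, and let $\phi:N\to[0,1]$ be a $1$-Lipschitz function which maps the distinguished point of $N$ to that of $[0,1]$. If the composition operator $C_\phi:\mathrm{Lip}_0([0,1])\to\mathrm{Lip}_0(N)$, $C_\phi(f)=f\circ\phi$, is an isometry, then for every $x\in[0,1]$ there exist sequences $\{x_n\},\{y_n\}$ in $N$ (with $x_n\neq y_n$ for every $n$) such that: (1) $\phi(x_n)\to x$ and $\phi(y_n)\to x$; (2) $\displaystyle\frac{d(\phi(x_n),\phi(y_n))}{d(x_n,y_n)}\longrightarrow 1$.
   Context: A pointed metric space is a metric space with a distinguished point. For a pointed metric space $M$, $\mathrm{Lip}_0(M)$ is the real Banach space of all Lipschitz functions $f:M\to\mathbb R$ vanishing at the distinguished point, with norm $\|f\|=\sup\{\frac{f(x)-f(y)}{d(x,y)}: x\neq y\in M\}$. ''$C_\phi$ is an isometry'' means $\|C_\phi(f)\|=\|f\|$ for all $f$ in its domain (no surjectivity is required). *)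

(* Defs.v *)
From HB Require Import structures.
From mathcomp Require Import all_boot all_order all_algebra.
From mathcomp Require Import all_classical all_reals all_analysis.

Set Implicit Arguments.
Unset Strict Implicit.
Unset Printing Implicit Defensive.

Import Order.TTheory GRing.Theory Num.Theory.
Import numFieldNormedType.Exports.

Local Open Scope classical_set_scope.
Local Open Scope ring_scope.

Definition unit_interval (R : realType) := {x : R | 0 <= x <= 1}.

Section unit_interval_metric.
Context {R : realType}.
Implicit Types u v w : unit_interval R.

HB.instance Definition _ := SubType.on (unit_interval R).
HB.instance Definition _ := Choice.on (unit_interval R).

Let dist u v : R := `|\val u - \val v|.

Let distxx u : dist u u = 0.
Proof. by rewrite /dist subrr normr0. Qed.

Let dist_positivity u v : dist u v = 0 -> u = v.
Proof. by move=> /normr0_eq0/subr0_eq/val_inj. Qed.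

Let dist_sym u v : dist u v = dist v u.
Proof. exact: distrC. Qed.

Let dist_triangle v u w : dist u w <= dist u v + dist v w.
Proof. exact: ler_distD. Qed.

HB.instance Definition _ := @isMetric.Build R (unit_interval R)
  dist distxx dist_positivity dist_sym dist_triangle.

Lemma mdist_unit_intervalE u v : mdist u v = `|\val u - \val v|.
Proof. by []. Qed.

End unit_interval_metric.

(* The library's [k.-lipschitz f] is only available between normed modules. *)
Definition klipschitz (R : realType) (M M' : metricType R) (k : R)
    (f : M -> M') : Prop :=
  forall x y, mdist (f x) (f y) <= k * mdist x y.

(* A pointed metric space is a metric space [M] together with a point [o];
   [R^o] is the real line with its usual metric. *)
Record Lip0 (R : realType) (M : metricType R) (o : M) := MkLip0 {
  Lip0_fun :> M -> R^o ;
  Lip0_lipschitz : exists k : R, klipschitz k Lip0_fun ;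
  Lip0_base : Lip0_fun o = 0 }.

(* The set is bounded above since [f] is Lipschitz; when [M] is a singleton it
   is empty and [sup set0 = 0]. *)
Definition Lip0_norm (R : realType) (M : metricType R) (o : M)
    (f : Lip0 o) : R :=
  sup [set (f p.1 - f p.2) / mdist p.1 p.2 | p in [set p : M * M | p.1 <> p.2]].

Section composition_operator.
Context {R : realType} {M N : metricType R} {oM : M} {oN : N}.
Variable phi : N -> M.
Hypotheses (phi_lip : klipschitz 1 phi) (phi_base : phi oN = oM).

Lemma comp_lipschitz (f : Lip0 oM) :
  exists k : R, klipschitz k ((f \o phi) : N -> R^o).
Proof.
have [k fk] := Lip0_lipschitz f; exists `|k| => x y /=.
apply: (le_trans (fk _ _)).
apply: (@le_trans _ _ (`|k| * mdist (phi x) (phi y))).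
  by rewrite ler_wpM2r ?mdist_ge0 ?ler_norm.
by rewrite ler_wpM2l//; have := phi_lip x y; rewrite mul1r.
Qed.

Lemma comp_base (f : Lip0 oM) : (f \o phi) oN = 0.
Proof. by rewrite /= phi_base Lip0_base. Qed.

Definition composition_operator (f : Lip0 oM) : Lip0 oN :=
  MkLip0 (comp_lipschitz f) (comp_base f).

End composition_operator.

Definition Lip0_isometry (R : realType) (M N : metricType R) (oM : M) (oN : N)
    (T : Lip0 oM -> Lip0 oN) : Prop :=
  forall f, Lip0_norm (T f) = Lip0_norm f.

(* Main.v *)
(* Test C_phi on the bump [f t = min (|t - x|) e], which has norm 1.  Since
   [C_phi f] also has norm 1, some pair [p], [q] of points of [N] has slope at
   least [1 - e] under [f \o phi]; as [f] and [phi] are 1-Lipschitz, both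
   [|phi p - phi q| / d(p, q)] and the slope of [f] between [phi p] and [phi q]
   are at least [1 - e].  But [f] takes values in [[0, e]] and is constant
   outside the [e]-ball around [x], so [phi p] and [phi q] are within [3 e]
   of [x]. *)
Require Import Defs.
From HB Require Import structures.
From mathcomp Require Import all_boot all_order all_algebra.
From mathcomp Require Import all_classical all_reals all_analysis.
From mathcomp Require Import lra.

Import Order.TTheory GRing.Theory Num.Theory.
Import numFieldNormedType.Exports.

Local Open Scope classical_set_scope.
Local Open Scope ring_scope.

Section slopes.
Context {R : realType} {M : metricType R} {o : M}.

Definition slopes (f : Lip0 o) : set R :=
  [set (f p.1 - f p.2) / mdist p.1 p.2 | p in [set p : M * M | p.1 <> p.2]].

Lemma slopes_ubound (f : Lip0 o) (k : R) :
  klipschitz k f -> ubound (slopes f) k.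
Proof.
move=> fk _ [[u v]] /= uv <-; rewrite ler_pdivrMr ?mdist_gt0; last exact/eqP.
by apply: le_trans (ler_norm _) _; rewrite distrC; exact: fk u v.
Qed.

(** A positive norm excludes the empty set of slopes, whose [sup] is 0 by default, so the supremum
    is genuine and is approached by actual slopes. *)
Lemma Lip0_norm_approx (f : Lip0 o) (e : R) :
    0 < e -> 0 < Lip0_norm f ->
  exists p : M * M, p.1 <> p.2 /\
    Lip0_norm f - e < (f p.1 - f p.2) / mdist p.1 p.2.
Proof.
move=> e0 f0; have slopes_sup : has_sup (slopes f).
  split; last by have [k /slopes_ubound fk] := Lip0_lipschitz f; exists k.
  apply/set0P/eqP => sf0; move: f0.
  by rewrite /Lip0_norm -/(slopes f) sf0 sup0 ltxx.
by have [_ [p pp <-]] := sup_adherent e0 slopes_sup; exists p.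
Qed.

End slopes.

Lemma minr_lipschitz (R : realType) (e a b : R) :
  `|Num.min a e - Num.min b e| <= `|a - b|.
Proof.
by rewrite !minElt; case: ltrP => ?; case: ltrP => ?;
  rewrite ler_norml; have [?|?] := ger0P (a - b); lra.
Qed.

(** Here [a] and [b] stand for the distances of two points to the centre, and [d] for their mutual
    distance. If both are at least [e], the truncations agree, against [0 < d]. If only [a] is, then
    [d / 2 <= (1 - e) * d <= e - b], whence [a <= d + b <= 2 * e]. *)
Lemma minr_steep (R : realType) (a b d e : R) :
    0 < d -> 0 <= b -> a <= d + b -> 0 < e -> e <= 1 / 2 ->
  (1 - e) * d <= `|Num.min a e - Num.min b e| -> a <= 3 * e.
Proof.
move=> d0 b0 abd e0 e12; rewrite !minElt.
have [ae|ae] := ltrP a e; have [be|be] := ltrP b e; rewrite ?subrr ?normr0.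
- by lra.
- by lra.
- by rewrite ger0_norm => [?|]; nra.
- by move=> ?; nra.
Qed.

(** Since [e <= 1 / 2], stepping by [e] from [a] towards the farther endpoint stays in the
    interval. *)
Lemma unit_interval_dist_eq (R : realType) (a e : R) :
    0 <= a <= 1 -> 0 <= e -> e <= 1 / 2 ->
  exists2 t, 0 <= t <= 1 & `|t - a| = e.
Proof.
move=> /andP[a0 a1] e0 e12; have [ah|ah] := leP a (1 / 2).
  by exists (a + e); [apply/andP; split; lra | rewrite addrC addKr ger0_norm].
exists (a - e); first by apply/andP; split; lra.
by rewrite addrAC subrr add0r normrN ger0_norm.
Qed.

Section bump.
Context {R : realType} (o x : unit_interval R) (e : R).
Hypotheses (e_gt0 : 0 < e) (e_le12 : e <= 1 / 2).
Implicit Types u v : unit_interval R.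

Let g u : R := Num.min `|val u - val x| e.

(** Subtracting the constant [g o] gives the value 0 at the base point without changing any
    slope. *)
Let bump_fun u : R^o := g u - g o.

Let g_dist u v : `|g u - g v| <= `|val u - val v|.
Proof.
apply: le_trans (minr_lipschitz _ _ _ _) _.
apply: le_trans (ler_dist_dist _ _) _.
by rewrite opprB addrA subrK.
Qed.

Lemma bump_fun_lipschitz : klipschitz 1 bump_fun.
Proof.
move=> u v; rewrite mul1r mdist_unit_intervalE distrC.
by rewrite /mdist/= /bump_fun opprB addrA subrK.
Qed.

Definition bump : Lip0 o :=
  MkLip0 (ex_intro _ 1 bump_fun_lipschitz) (subrr (g o)).

Lemma bumpB u v : bump u - bump v = g u - g v.
Proof. by rewrite /bump/= /bump_fun opprB addrA subrK. Qed.

Lemma bump_dist u v : `|bump u - bump v| <= mdist u v.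
Proof. by rewrite bumpB mdist_unit_intervalE. Qed.

Lemma bump_norm : Lip0_norm bump = 1.
Proof.
have bump1 : ubound (slopes bump) 1 by exact/slopes_ubound/bump_fun_lipschitz.
have [y xy] : exists y : unit_interval R, `|val y - val x| = e.
  have [t t01 te] := unit_interval_dist_eq _ _ _ (valP x) (ltW e_gt0) e_le12.
  by exists (exist _ t t01).
(* The bound 1 is attained: between [x] and a point at distance exactly [e], [g] rises from 0 to
   [e]. *)
have slope1 : slopes bump 1.
  exists (y, x) => /=.
    by move=> yx; move: xy e_gt0; rewrite yx subrr normr0 => <-; rewrite ltxx.
  rewrite bumpB mdist_unit_intervalE xy /g xy subrr normr0 minxx.
  by rewrite (min_idPl (ltW e_gt0)) subr0 divff// gt_eqF.
apply/eqP; rewrite eq_le; apply/andP; split.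
  by apply: ge_sup => //; exists 1.
by apply: (ub_le_sup _ slope1); exists 1.
Qed.

Lemma bump_steep u v : u <> v -> (1 - e) * mdist u v <= `|bump u - bump v| ->
  mdist x u <= 3 * e.
Proof.
move=> /eqP; rewrite -mdist_gt0 bumpB !mdist_unit_intervalE => uv.
have tri : `|val u - val x| <= `|val u - val v| + `|val v - val x|.
  exact: ler_distD.
by rewrite [X in X <= 3 * e]distrC; apply: minr_steep uv _ tri e_gt0 e_le12.
Qed.

End bump.

Section near_pairs.
Context {R : realType} {N : metricType R} {oN : N} {o : unit_interval R}.
Variable phi : N -> unit_interval R.
Hypotheses (phi_lip : klipschitz 1 phi) (phi_base : phi oN = o).

Lemma isometry_steep_pair (x : unit_interval R) (e : R) :
    Lip0_isometry (composition_operator phi_lip phi_base) ->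
    0 < e -> e <= 1 / 2 ->
  exists p : N * N, [/\ p.1 <> p.2,
    mdist x (phi p.1) <= 3 * e, mdist x (phi p.2) <= 3 * e &
    1 - e <= mdist (phi p.1) (phi p.2) / mdist p.1 p.2 <= 1].
Proof.
move=> isom e0 e12; pose f := bump o x e.
have Tf1 : Lip0_norm (composition_operator phi_lip phi_base f) = 1.
  by rewrite isom bump_norm.
have [||[p q] /= [pq]] :=
    Lip0_norm_approx (composition_operator phi_lip phi_base f) e => //.
  by rewrite Tf1.
have d0 : 0 < mdist p q by rewrite mdist_gt0; exact/eqP.
rewrite Tf1 ltr_pdivlMr// => slope.
have fpq : (1 - e) * mdist p q < `|f (phi p) - f (phi q)|.
  exact: lt_le_trans slope (ler_norm _).
have fphi := bump_dist o x e (phi p) (phi q).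
have := phi_lip p q; rewrite mul1r => phi1.
(* As [phi] does not increase distances, steepness relative to [mdist p q] passes to the images. *)
have fpq' : (1 - e) * mdist (phi p) (phi q) <= `|f (phi p) - f (phi q)|.
  by apply: le_trans (ltW fpq); rewrite ler_wpM2l//; lra.
have phipq : phi p <> phi q.
  by move=> pq'; move: fpq; rewrite pq' subrr normr0; nra.
exists (p, q) => /=; split => //.
- exact: (bump_steep o x e e0 e12 (phi p) (phi q)).
(* [bump_steep] locates only its first point, so the pair is swapped to locate the other. *)
- apply: (bump_steep o x e e0 e12 (phi q) (phi p)); first exact: nesym.
  by rewrite metric_sym distrC.
- rewrite ler_pdivlMr// ler_pdivrMr// mul1r phi1 andbT.
  exact: ltW (lt_le_trans fpq fphi).
Qed.

End near_pairs.

Lemma cvg_mdist_le (R : realType) (M : metricType R) (u : nat -> M) (x : M)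
    (e : nat -> R) :
  (forall n, mdist x (u n) <= e n) -> e n @[n --> \oo] --> (0 : R) ->
  u n @[n --> \oo] --> x.
Proof.
move=> ue e0; apply/metricType_numDomainType.cvgrPdist_lt => _/posnumP[d].
have /cvgrPdist_lt/(_ _ (gt0 d)) := e0; apply: filterS => n.
rewrite sub0r normrN; apply: le_lt_trans.
exact: le_trans (ue n) (ler_norm _).
Qed.

Theorem proposition3p1 (R : realType) (N : metricType R) (oN : N)
    (o : unit_interval R) (phi : N -> unit_interval R)
    (phi_lip : klipschitz 1 phi) (phi_base : phi oN = o) :
  Lip0_isometry (composition_operator phi_lip phi_base) ->
  forall x : unit_interval R,
  exists x_ y_ : nat -> N,
    [/\ forall n, x_ n <> y_ n,
        phi (x_ n) @[n --> \oo] --> x,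
        phi (y_ n) @[n --> \oo] --> x &
        mdist (phi (x_ n)) (phi (y_ n)) / mdist (x_ n) (y_ n)
          @[n --> \oo] --> (1 : R)].
Proof.
(* Starting at [2^-1] ensures [e n <= 1 / 2] already for [n = 0]; this is the harmonic sequence
   shifted by one. *)
move=> isom x; pose e n : R := n.+2%:R^-1.
have e_cvg0 : e n @[n --> \oo] --> (0 : R).
  exact: (cvg_comp _ _ (cvg_addnl 1%N) cvg_harmonic).
have e3_cvg0 : 3 * e n @[n --> \oo] --> (0 : R).
  by rewrite -[X in _ --> X](mulr0 3); exact: cvgM (cvg_cst _) e_cvg0.
have /choice[p pP] : forall n, exists p : N * N, [/\ p.1 <> p.2,
    mdist x (phi p.1) <= 3 * e n, mdist x (phi p.2) <= 3 * e n &
    1 - e n <= mdist (phi p.1) (phi p.2) / mdist p.1 p.2 <= 1].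
  move=> n; apply: isometry_steep_pair isom _ _; first by rewrite /e invr_gt0.
  by rewrite /e div1r lef_pV2 ?posrE// ler_nat.
exists (fst \o p), (snd \o p); split.
- by move=> n; have [] := pP n.
- by apply: cvg_mdist_le e3_cvg0 => n; have [] := pP n.
- by apply: cvg_mdist_le e3_cvg0 => n; have [] := pP n.
- apply: (@squeeze_cvgr _ _ _ _ (fun n => 1 - e n) (fun=> 1)).
  + by apply: nearW => n; have [] := pP n.
  + by rewrite -[X in _ --> X](subr0 1); apply: cvgB => //; exact: cvg_cst.
  + exact: cvg_cst.
Qed.
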